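(* Let $\tilde w=s_{\beta_1}\cdots s_{\beta_r}$ be an expression (not necessarily reduced) in simple reflections of the Weyl group of a Kac-Moody group $G$, with toric limit $Y_{\tilde w}$. Let $1\le j\le r$ and let $L_j$ be the Schubert line in $Y_{\tilde w}$. Then $$K_{Y_{\tilde w}}\cdot L_j=-2-\sum_{k>j}\beta_{jk},\qquad \beta_{jk}=\langle\beta_k,\check\beta_j\rangle .$$
   Context: We work over $\mathbb C$. $G$ is a Kac-Moody group; the $\beta_i$ are simple roots and $\beta_{ij}:=\langle\beta_j,\check\beta_i\rangle$, with $\check\beta_i$ the coroot of $\beta_i$. The toric limit $Y_{\tilde w}$ (the special fibre of a toric degeneration of the Bott-Samelson-Demazure-Hansen variety $Z(\tilde w)$) is the smooth projective toric variety whose fan $\Sigma$ in $\mathbb R^r$ has as cones those generated by subsets of $\{e_1^{\pm},\dots,e_r^{\pm}\}$ containing no pair $\{e_i^+,e_i^-\}$, where $e_1^+,\dots,e_r^+$ is the standard basis of $\mathbb Z^r$ and $e_i^-:=-e_i^+-\sum_{j>i}\beta_{ij}e_j^+$. For $1\le j\le r$ let $\tilde w_j=s_{\beta_1}\cdots s_{\beta_j}$. Projection $\mathbb Z^j\to\mathbb Z^{j-1}$ onto the first $j-1$ coordinates induces a toric $\mathbb P^1$-fibration $f_j:Y_{\tilde w_j}\to Y_{\tilde w_{j-1}}$ ($Y_{\tilde w_0}$ a point). Its Schubert section is the toric section $Y_{\tilde w_{j-1}}\to Y_{\tilde w_j}$ whose image is the toric divisor of the ray generated by $e_j^+$. The Schubert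 point of $Y_{\tilde w_j}$ is the torus-fixed point of the cone generated by $e_1^+,\dots,e_j^+$. The Schubert line $L_j\subset Y_{\tilde w_j}$ is the fibre of $f_j$ over the Schubert point of $Y_{\tilde w_{j-1}}$; its image in $Y_{\tilde w}$ under the composition of the Schubert sections $Y_{\tilde w_j}\to Y_{\tilde w_{j+1}}\to\cdots\to Y_{\tilde w_r}=Y_{\tilde w}$ is also denoted $L_j$. *)

(* Defs.v *)
From mathcomp Require Import all_boot all_order all_algebra.
From mathcomp Require Import boolp classical_sets fsbigop reals.
From mathcomp Require Import complex.

Set Implicit Arguments.
Unset Strict Implicit.
Unset Printing Implicit Defensive.

Import Order.TTheory GRing.Theory Num.Theory.

Local Open Scope classical_set_scope.
Local Open Scope ring_scope.

(* The pairing between characters and one-parameter subgroups of a torus, both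
   lattices being identified with 'rV[int]_n by dual bases. *)
Definition pairing n (m v : 'rV[int]_n) : int := \sum_(i < n) m 0 i * v 0 i.

(* Kac-Moody root datum: simple roots in a lattice, simple coroots in the dual
   lattice, such that (i, j) |-> <alpha_j, coroot_i> is a generalized Cartan
   matrix. *)
Record kac_moody_datum := KacMoodyDatum {
  km_index : finType;
  km_dim : nat;
  km_root : km_index -> 'rV[int]_km_dim;
  km_coroot : km_index -> 'rV[int]_km_dim;
  _ : forall i, pairing (km_root i) (km_coroot i) = 2;
  _ : forall i j, i != j -> pairing (km_root j) (km_coroot i) <= 0;
  _ : forall i j, pairing (km_root j) (km_coroot i) = 0 ->
                  pairing (km_root i) (km_coroot j) = 0
}.

(* An expression in simple reflections is the word w of the indices of the
   simple roots; positions are numbered from 0.  The values for i or k outside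
   the word are 0 and are never used. *)
Definition word_beta (D : kac_moody_datum) (w : seq (km_index D)) (i k : nat)
    : int :=
  pairing (nth 0 [seq km_root x | x <- w] k)
          (nth 0 [seq km_coroot x | x <- w] i).

Section ToricLimit.

(* Only the entries beta i k with i, k < n enter the n-dimensional variety.
   Thus, for a word of length r and n <= r, beta := word_beta w gives the toric
   limit of the prefix of length n of w. *)
Variable beta : nat -> nat -> int.

(* (i, true) stands for e_i^+ and (i, false) for e_i^-. *)
Definition ray n (x : 'I_n * bool) : 'rV[int]_n :=
  if x.2 then delta_mx 0 x.1
  else - delta_mx 0 x.1
       - \sum_(k < n | (x.1 < k)%N) beta x.1 k *: delta_mx 0 k.

(* A cone is represented by the set of its generators among the e_i^+, e_i^-. *)
Definition fan n : {set {set 'I_n * bool}} :=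
  [set A : {set 'I_n * bool} |
    [forall i, ~~ (((i, true) \in A) && ((i, false) \in A))]]%SET.

Definition dual_cone n (A : {set 'I_n * bool}) (m : 'rV[int]_n) : bool :=
  [forall x in A, 0 <= pairing m (ray x)].

Definition perp_cone n (A : {set 'I_n * bool}) (m : 'rV[int]_n) : bool :=
  [forall x in A, pairing m (ray x) == 0].

(* The closed points of the affine chart of a cone are the monoid morphisms
   from its dual cone to K.  A point p of the toric variety is recorded as the
   partial function sending a character to its value at p, defined on all the
   characters that are regular at p.  These form the dual of the smallest cone
   whose chart contains p, i.e. of the cone of the torus orbit of p; on this
   cone the morphism vanishes exactly on the non-invertible characters.  Hence
   each point has exactly one representation. *)
Definition germ (K : Type) n := 'rV[int]_n -> option K.

Definition torus_orbit (K : fieldType) n (A : {set 'I_n * bool}) : set (germ K n) :=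
  [set p | [/\ forall m, isSome (p m) = dual_cone A m,
               p 0 = Some 1,
               forall m m' x x', p m = Some x -> p m' = Some x' ->
                 p (m + m') = Some (x * x')
             & forall m x, p m = Some x -> x != 0 -> isSome (p (- m))]].

(* The K-points of the toric variety. *)
Definition toric_limit (K : fieldType) n : set (germ K n) :=
  [set p | exists2 A, A \in fan n & torus_orbit A p].

Definition toric_divisor (K : fieldType) n (x : 'I_n * bool) : set (germ K n) :=
  [set p | exists A, [/\ A \in fan n, x \in A & torus_orbit A p]].

Definition torus_fixed_point (K : fieldType) n (A : {set 'I_n * bool})
    : germ K n :=
  fun m => if dual_cone A m then Some (perp_cone A m)%:R else None.

Definition schubert_point (K : fieldType) n : germ K n :=
  torus_fixed_point K [set (i, true) | i : 'I_n]%SET.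

(* The toric morphism induced by the map of lattices v |-> v *m F, when it maps
   each cone onto a cone, so that the characters regular at the image of p are
   those whose pullback is regular at p. *)
Definition toric_map (K : Type) n n' (F : 'M[int]_(n, n')) (p : germ K n)
    : germ K n' :=
  fun m => p (m *m F^T).

Definition fibration (K : Type) n : germ K n.+1 -> germ K n :=
  toric_map (pid_mx n).

(* The section of the fibration whose image is the divisor of the last e^+;
   the fallback value of xget is not a point. *)
Definition schubert_section (K : fieldType) n (p : germ K n) : germ K n.+1 :=
  xget (fun=> None)
    [set q | toric_divisor (ord_max, true) q /\ fibration q = p].

(* The image in dimension n of the Schubert line with (0-based) index j, which
   first appears as a fibre in dimension j.+1; meaningful for j < n. *)
Fixpoint schubert_line (K : fieldType) (j n : nat) : set (germ K n) :=
  match n with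
  | 0 => set0
  | n'.+1 =>
      if n' == j then
        [set q | toric_limit q /\ fibration q = @schubert_point K n']
      else @schubert_section K n' @` @schubert_line K j n'
  end.

(* Maximal cones are given by a sign for each index; the chart of a maximal
   cone is an affine space with coordinates the characters of the basis dual to
   the generators. *)
Definition chart n := {ffun 'I_n -> bool}.

Definition generators n (s : chart n) : 'M[int]_n := \matrix_i ray (i, s i).

Definition dual_basis n (s : chart n) (i : 'I_n) : 'rV[int]_n :=
  (col i (invmx (generators s)))^T.

Definition in_chart (K : Type) n (s : chart n) (p : germ K n) : bool :=
  [forall i, isSome (p (dual_basis s i))].

Definition chart_coord (K : fieldType) n (s : chart n) (p : germ K n) (i : 'I_n)
    : K :=
  odflt 0 (p (dual_basis s i)).

(* Coordinate i of the chart t is the Laurent monomial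
   \prod_k x_k ^ (transition s t i k) in the coordinates x of the chart s. *)
Definition transition n (s t : chart n) (i k : 'I_n) : int :=
  pairing (dual_basis t i) (ray (k, s k)).

(* The derivative of \prod_k x_k ^ (a k) with respect to x_l. *)
Definition monomial_deriv (K : fieldType) n (a : 'I_n -> int) (l : 'I_n)
    (x : 'I_n -> K) : K :=
  (a l)%:~R * \prod_k x k ^ (a k - (k == l)%:Z).

Definition jacobian (K : fieldType) n (s t : chart n) (p : germ K n) : 'M[K]_n :=
  \matrix_(i, l) monomial_deriv (transition s t i) l (chart_coord s p).

(* The value g s t at a point of a cocycle g of a line bundle is the quotient
   e_t / e_s of its trivializing sections e_s, e_t over the charts s and t.
   For the canonical bundle, e_s = dx_1 /\ ... /\ dx_n. *)
Definition cocycle (K : Type) n := chart n -> chart n -> germ K n -> K.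

Definition canonical_cocycle (K : fieldType) n : cocycle K n :=
  fun s t p => \det (jacobian s t p).

Section Curves.

Variable C : fieldType.

Local Notation "'C(z)'" := {fraction {poly C}}.

(* Points of the projective line over C; None is the point at infinity. *)
Local Notation P1 := (option C).

(* The order of vanishing of a nonzero rational function. *)
Definition ord_at (c : P1) (f : C(z)) : int :=
  let a := \n_(repr f) in let b := \d_(repr f) in
  if c is Some c then (mup c a)%:Z - (mup c b)%:Z
  else (size b)%:Z - (size a)%:Z.

Definition has_value_at (c : P1) (f : C(z)) (v : C) : Prop :=
  let g := f - tofrac v%:P in g = 0 \/ 0 < ord_at c g.

(* As the toric limit is complete, a morphism from the projective line to it is
   the same as a C(z)-point of it. *)
Definition regular_at n (c : P1) (s : chart n) (nu : germ C(z) n) : Prop :=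
  in_chart s nu /\ forall i, exists v, has_value_at c (chart_coord s nu i) v.

(* The point q is nu(c). *)
Definition image_point n (nu : germ C(z) n) (c : P1) (q : germ C n) : Prop :=
  toric_limit q /\
  exists s : chart n, [/\ in_chart s nu, in_chart s q &
    forall i, has_value_at c (chart_coord s nu i) (chart_coord s q i)].

(* nu is surjective onto L and generically injective; in characteristic 0 this
   means that it is the normalization of the rational curve L. *)
Definition normalization n (nu : germ C(z) n) (L : set (germ C n)) : Prop :=
  [/\ toric_limit nu,
      [set q | exists c, image_point nu c q] = L
    & exists S : seq P1, forall c c' q, c \notin S -> c' \notin S ->
        image_point nu c q -> image_point nu c' q -> c = c'].

(* d is the degree of the pullback by nu of the line bundle with cocycle g: the
   degree of the divisor of a nonzero rational section, which is h s times the
   trivializing section of each chart s met by the curve; near each point c it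
   is computed in a chart a c containing nu(c). *)
Definition pullback_degree n (g : cocycle C(z) n) (nu : germ C(z) n) (d : int)
    : Prop :=
  exists (h : chart n -> C(z)) (a : P1 -> chart n),
    [/\ forall s, in_chart s nu -> h s != 0,
        forall s t, in_chart s nu -> in_chart t nu -> h s = h t * g s t nu,
        forall c, regular_at c (a c) nu
      & d = \sum_(c \in [set: P1]) ord_at c (h (a c))].

(* The intersection number of a line bundle with a rational curve. *)
Definition intersection_number n (g : cocycle C(z) n) (L : set (germ C n))
    : int :=
  xget 0 [set d | exists2 nu, normalization nu L & pullback_degree g nu d].

(* The intersection number of the canonical divisor with a rational curve. *)
Definition canonical_degree n (L : set (germ C n)) : int :=
  intersection_number (@canonical_cocycle _ n) L.

End Curves.

End ToricLimit.

Arguments schubert_line : clear implicits.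
Arguments toric_limit : clear implicits.

(* Main.v *)
(* In the chart of the cone e_1^+, ..., e_r^+ the curve L_j is the j-th coordinate
   axis, and it is completed by one point in the chart where e_j^+ is replaced by
   e_j^-.  Along the axis the coordinates y of the second chart are
   y_j = 1 / x_j and y_k = x_k * x_j ^ (- beta_jk) for k > j, so the Jacobian is
   - x_j ^ (- 2 - sum_(k > j) beta_jk); its order at the two points gives the
   degree for the parametrization x_j = z.  Any other normalization has x_j = p / q
   for a rational function; the degree is then multiplied by the degree of p / q,
   which is 1 by generic injectivity since a generic fibre of p / q is reduced in
   characteristic 0. *)
Require Import Defs.
From mathcomp Require Import all_boot all_order all_algebra.
From mathcomp Require Import boolp classical_sets fsbigop reals.
From mathcomp Require Import complex.
From mathcomp Require Import fraction polydiv generic_quotient ring.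

Set Implicit Arguments.
Unset Strict Implicit.
Unset Printing Implicit Defensive.

Import Order.TTheory GRing.Theory Num.Theory.

Local Open Scope classical_set_scope.
Local Open Scope ring_scope.

(** * Orders of rational functions *)

Local Notation "p %:F" := (tofrac p).

Section Orders.

Variable C : fieldType.
Implicit Types (p q : {poly C}) (f g : {fraction {poly C}}) (c : option C) (x v : C).

(** Links [ord_at], which is defined through the representative [repr f], to quotients of
    polynomials. *)
Lemma fraction_repr f : f = (\n_(repr f))%:F / (\d_(repr f))%:F.
Proof.
have d0 : (\d_(repr f))%:F != 0 by rewrite tofrac_eq0 denom_ratioP.
apply: (mulIf d0); rewrite divfK // -{1}[f]reprK; unlock tofrac.
rewrite -[LHS]FracField.pi_mul; apply/eqP; rewrite FracField.equivf_def.
by rewrite /FracField.mulf !numden_Ratio ?mulr1 ?oner_eq0 ?denom_ratioP // mulrC.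
Qed.

(** The pole at infinity has order the degree. At [p = 0] the value is meaningless, hence the
    nonvanishing hypotheses below. *)
Definition ord_poly c p : int := if c is Some x then (mup x p)%:Z else - (size p).-1%:Z.

Lemma ord_polyM c p q : p != 0 -> q != 0 ->
  ord_poly c (p * q) = ord_poly c p + ord_poly c q.
Proof.
case: c => [x|] p0 q0 /=; first by rewrite mupM.
rewrite size_mul // -opprD -PoszD; congr (- Posz _).
by rewrite (polySpred p0) (polySpred q0) addnS.
Qed.

Lemma fraction_neq0 f : f != 0 ->
  exists p q, [/\ p != 0, q != 0 & f = p%:F / q%:F].
Proof.
move=> f0; exists (\n_(repr f)), (\d_(repr f)); split.
- by apply: contraNneq f0 => n0; rewrite (fraction_repr f) n0 tofrac0 mul0r.
- exact: denom_ratioP.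
- exact: fraction_repr.
Qed.

Lemma fraction_coprime f :
  exists pq : {poly C} * {poly C},
    [/\ coprimep pq.1 pq.2, pq.2 != 0 & f = pq.1%:F / pq.2%:F].
Proof.
have [->|/fraction_neq0[p [q [p0 q0 ->]]]] := eqVneq f 0.
  by exists (0, 1); rewrite /= coprimep1 oner_eq0 tofrac0 mul0r.
have g0 : gcdp p q != 0 by rewrite gcdp_eq0 (negPf p0).
have [pE qE] := (divpK (dvdp_gcdl p q), divpK (dvdp_gcdr p q)).
exists (p %/ gcdp p q, q %/ gcdp p q); split=> /=.
- by rewrite coprimep_div_gcd ?p0.
- by apply: contraNneq q0 => E; rewrite -qE E mul0r.
have -> : p%:F = (p %/ gcdp p q)%:F * (gcdp p q)%:F by rewrite -tofracM pE.
have -> : q%:F = (q %/ gcdp p q)%:F * (gcdp p q)%:F by rewrite -tofracM qE.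
by rewrite invfM mulrACA divff ?mulr1 // tofrac_eq0.
Qed.

(** Independence of the representative: two quotients representing [f] satisfy a cross-multiplied
    identity of polynomials, on which [ord_poly] is additive. *)
Lemma ord_at_fraction c p q : p != 0 -> q != 0 ->
  ord_at c (p%:F / q%:F) = ord_poly c p - ord_poly c q.
Proof.
move=> p0 q0; set f := _ / _.
have f0 : f != 0 by rewrite mulf_neq0 ?invr_eq0 ?tofrac_eq0.
have d0 : \d_(repr f) != 0 by apply: denom_ratioP.
have n0 : \n_(repr f) != 0.
  by apply: contraNneq f0 => n0; rewrite (fraction_repr f) n0 tofrac0 mul0r.
have -> : ord_at c f = ord_poly c \n_(repr f) - ord_poly c \d_(repr f).
  rewrite /ord_at; case: c => //=.
  by rewrite (polySpred n0) (polySpred d0) /= !intS opprK addrC opprD addrACA subrr add0r.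
have E : p * \d_(repr f) = \n_(repr f) * q.
  apply/eqP; rewrite -tofrac_eq !tofracM -eqr_div ?tofrac_eq0 //.
  by rewrite -fraction_repr.
have := ord_polyM c p0 d0; rewrite E ord_polyM // => H.
by apply/eqP; rewrite subr_eq addrAC -H addrK.
Qed.

Lemma ord_atM c f g : f != 0 -> g != 0 -> ord_at c (f * g) = ord_at c f + ord_at c g.
Proof.
move=> /fraction_neq0[p [q [p0 q0 ->]]] /fraction_neq0[p' [q' [p'0 q'0 ->]]].
rewrite mulrACA -invfM -!tofracM !ord_at_fraction ?mulf_neq0 // !ord_polyM //.
by rewrite opprD addrACA.
Qed.

Lemma ord_at_const c v : v != 0 -> ord_at c (v%:P)%:F = 0.
Proof.
move=> v0; rewrite -[_%:F]divr1 -tofrac1 ord_at_fraction ?polyC_eq0 ?oner_eq0 //.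
case: c => [x|] /=; last by rewrite size_polyC v0 size_poly1.
by rewrite !mupNroot ?root1 ?rootC // subrr.
Qed.

Lemma ord_at1 c : ord_at c 1 = 0.
Proof. by rewrite -(@ord_at_const c 1) ?oner_eq0 // polyC1 tofrac1. Qed.

Lemma ord_atV c f : f != 0 -> ord_at c f^-1 = - ord_at c f.
Proof.
move=> f0; apply/eqP; rewrite -addr_eq0 -ord_atM ?invr_eq0 // mulVf //.
by rewrite ord_at1.
Qed.

Lemma ord_atN c f : f != 0 -> ord_at c (- f) = ord_at c f.
Proof.
move=> f0; rewrite -mulN1r ord_atM ?oppr_eq0 ?oner_eq0 //.
rewrite -tofrac1 -tofracN -polyC1 -polyCN ord_at_const ?add0r //.
by rewrite oppr_eq0 oner_eq0.
Qed.

Lemma ord_atXn c f n : f != 0 -> ord_at c (f ^+ n) = ord_at c f * n%:Z.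
Proof.
move=> f0; elim: n => [|n IHn]; first by rewrite ord_at1 mulr0.
by rewrite exprS ord_atM ?expf_neq0 // IHn intS mulrDr mulr1.
Qed.

Lemma ord_atX c f (k : int) : f != 0 -> ord_at c (f ^ k) = ord_at c f * k.
Proof.
move=> f0; case: k => k; first exact: ord_atXn.
by rewrite NegzE -exprnN ord_atV ?expf_neq0 // ord_atXn // mulrN.
Qed.

(** The numerator of [p / q - p(x) / q(x)] vanishes at [x] and the denominator does not. *)
Lemma has_value_fraction x p q : q.[x] != 0 ->
  has_value_at (Some x) (p%:F / q%:F) (p.[x] / q.[x]).
Proof.
move=> qx; rewrite /has_value_at.
have q0 : q != 0 by apply: contraNneq qx => ->; rewrite horner0.
have -> : p%:F / q%:F - (p.[x] / q.[x])%:P%:F =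
    (p - (p.[x] / q.[x])%:P * q)%:F / q%:F.
  by rewrite tofracB tofracM mulrBl mulfK ?tofrac_eq0.
have [->|r0] := eqVneq (p - (p.[x] / q.[x])%:P * q) 0.
  by left; rewrite tofrac0 mul0r.
right; rewrite ord_at_fraction //= [mup x q]mupNroot // subr0.
by rewrite ltz_nat -XsubC_dvd // dvdp_XsubCl /root !hornerE divfK // subrr.
Qed.

(** A function with a finite value has no pole: write [p = (p - v q) + v q], where the first summand
    has higher order than [q] and the second at least that of [q]. *)
Lemma has_value_ord_ge0 c f v : f != 0 -> has_value_at c f v -> 0 <= ord_at c f.
Proof.
move=> f0; rewrite /has_value_at; have [->|v0] := eqVneq v 0.
  by rewrite tofrac0 subr0 => -[/eqP|/ltW //]; rewrite (negPf f0).
have [/eqP|g0] := eqVneq (f - v%:P%:F) 0.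
  by rewrite subr_eq0 => /eqP ->; rewrite ord_at_const.
case=> [/eqP|]; first by rewrite (negPf g0).
have [p [q [p0 q0 fE]]] := fraction_neq0 f0.
have gE : f - v%:P%:F = (p - v%:P * q)%:F / q%:F.
  by rewrite fE tofracB tofracM mulrBl mulfK ?tofrac_eq0.
have r0 : p - v%:P * q != 0.
  by apply: contraNneq g0 => r0; rewrite gE r0 tofrac0 mul0r.
rewrite gE fE !ord_at_fraction // subr_gt0 subr_ge0.
case: c => [x|] /=; last first.
  rewrite ltrN2 lerN2 ltz_nat lez_nat => /ltnW rq.
  rewrite -!subn1 leq_sub2r // -[p](subrK (v%:P * q)) (leq_trans (size_polyD _ _)) //.
  by rewrite geq_max size_Cmul // leqnn andbT (polySpred r0) (polySpred q0).
rewrite ltz_nat lez_nat => /ltnW; rewrite !mup_geq // => rq.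
by rewrite -[X in _ %| X](subrK (v%:P * q)) dvdp_add // dvdp_mull // -mup_geq.
Qed.

Lemma has_value0 c : has_value_at c 0 0.
Proof. by left; rewrite tofrac0 subr0. Qed.

Lemma has_value0_eq c v : has_value_at c 0 v -> v = 0.
Proof.
rewrite /has_value_at sub0r => vE; apply/eqP; apply: contraT => v0; move: vE.
rewrite ord_atN ?ord_at_const ?tofrac_eq0 ?polyC_eq0 // => -[/eqP|] //.
by rewrite oppr_eq0 tofrac_eq0 polyC_eq0 (negPf v0).
Qed.

Lemma has_valueX x v : has_value_at (Some x) ('X : {poly C})%:F v <-> v = x.
Proof.
split=> [|->]; last first.
  by have := @has_value_fraction x 'X 1; rewrite tofrac1 !divr1 !hornerE oner_eq0 divr1; apply.
rewrite /has_value_at -tofracB; case=> [/eqP|].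
  by rewrite tofrac_eq0 polyXsubC_eq0.
rewrite -[_%:F]divr1 -tofrac1 ord_at_fraction ?polyXsubC_eq0 ?oner_eq0 //= .
rewrite (mup_XsubCX 1) [mup x 1]mupNroot ?root1 // subr0.
by case: eqP.
Qed.

(** The conclusion is free of division, so it also rules out a value of [1 / X] at [x = 0]. *)
Lemma has_valueXV x v : has_value_at (Some x) ('X : {poly C})%:F^-1 v -> v * x = 1.
Proof.
have X0 : ('X : {poly C}) != 0 by rewrite polyX_eq0.
have r0 : 1 - v%:P * 'X != 0.
  apply/eqP => /(congr1 (fun p => p.[0])); rewrite !(hornerE, mulr0, subr0) => /eqP.
  by rewrite oner_eq0.
have E : ('X : {poly C})%:F^-1 - v%:P%:F = (1 - v%:P * 'X)%:F / ('X : {poly C})%:F.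
  by rewrite tofracB tofracM tofrac1 mulrBl mulfK ?tofrac_eq0 // mul1r.
rewrite /has_value_at E => -[/eqP|].
  by rewrite mulf_eq0 invr_eq0 !tofrac_eq0 (negPf X0) (negPf r0).
rewrite ord_at_fraction //= => H.
have: root (1 - v%:P * 'X) x.
  apply: contraTT H => rx; rewrite [mup x (_ - _)]mupNroot //.
  by rewrite sub0r oppr_gt0 ltz_nat.
by rewrite /root !hornerE subr_eq0 => /eqP.
Qed.

Lemma has_value_infty : has_value_at None ('X : {poly C})%:F^-1 0.
Proof.
right; rewrite tofrac0 subr0 -[_^-1]mul1r -tofrac1.
by rewrite ord_at_fraction ?polyX_eq0 ?oner_eq0 //= size_polyX size_poly1.
Qed.

End Orders.

(** * Degrees and generic fibres of rational functions over a closed field *)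

Section GenericFibre.

Variable C : numClosedFieldType.
Implicit Types (p q : {poly C}) (f g : {fraction {poly C}}) (x v : C) (s : seq C).

Lemma closed_avoid s : exists x : C, x \notin s.
Proof.
have /closed_nonrootP[x] : \prod_(y <- s) ('X - y%:P) != 0 :> {poly C}.
  by rewrite monic_neq0 ?monic_prod_XsubC.
by rewrite root_prod_XsubC; exists x.
Qed.

Lemma roots_seq p : p != 0 -> exists s, uniq s /\ (forall x, root p x -> x \in s).
Proof.
move=> p0; have [r pE] := closed_field_poly_normal p.
exists (undup r); split=> [|x]; first exact: undup_uniq.
by rewrite pE rootZ ?lead_coef_eq0 // root_prod_XsubC mem_undup.
Qed.

(** Since [p] splits, this counts its linear factors by their roots; points of [s] that are not
    roots contribute 0. *)
Lemma sum_mup p s : p != 0 -> uniq s -> (forall x, root p x -> x \in s) ->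
  (\sum_(x <- s) mup x p)%N = (size p).-1.
Proof.
move=> p0 us sP; have [r pE] := closed_field_poly_normal p.
have lp0 : lead_coef p != 0 by rewrite lead_coef_eq0.
rewrite {2}pE size_scale // size_prod_XsubC /=.
transitivity (\sum_(x <- s) \sum_(y <- r) (y == x : nat))%N.
  apply: eq_bigr => x _; rewrite pE -mul_polyC mupMr ?rootC // mu_prod_XsubC.
  by rewrite -sum1_count big_mkcond.
rewrite exchange_big /= -sum1_size [in LHS]big_seq [in RHS]big_seq.
apply: eq_bigr => y yr; under eq_bigr do rewrite eq_sym.
have -> : (\sum_(x <- s) (x == y : nat) = count_mem y s)%N.
  by rewrite -sum1_count [RHS]big_mkcond.
by rewrite count_uniq_mem // sP // pE rootZ // root_prod_XsubC.
Qed.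

(** The orders of [g] sum to 0. The minimum with 0 keeps only the poles of [p / q], whose number
    with multiplicity is the degree of [p / q] as a map. The term in [M] will account for changing
    chart at these poles. *)
Lemma sum_ord_at (M : int) g p q : g != 0 -> p != 0 -> q != 0 -> coprimep p q ->
  \sum_(c \in [set: option C])
     (ord_at c g + Order.min (ord_at c (p%:F / q%:F)) 0 * M) =
  - (maxn (size p) (size q)).-1%:Z * M.
Proof.
move=> g0 p0 q0 pq; have [a [b [a0 b0 gE]]] := fraction_neq0 g0.
have abq0 : a * b * q != 0 by rewrite !mulf_neq0.
have [s [us sP]] := roots_seq abq0.
have aP x : root a x -> x \in s by move=> ax; rewrite sP // !rootM ax.
have bP x : root b x -> x \in s by move=> bx; rewrite sP // !rootM bx orbT.
have qP x : root q x -> x \in s by move=> qx; rewrite sP // !rootM qx orbT.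
pose F c := ord_at c g + Order.min (ord_at c (p%:F / q%:F)) 0 * M.
(* By coprimality [p] does not vanish at a root of [q], so the pole there has order exactly the
   multiplicity in [q]. *)
have FE x : F (Some x) = (mup x a)%:Z - (mup x b)%:Z - (mup x q)%:Z * M.
  rewrite /F gE !ord_at_fraction //= -mulNr; congr (_ + _ * M).
  have [qx|qx] := boolP (root q x); last first.
    by rewrite [mup x q]mupNroot // subr0 oppr0; apply/min_idPr; rewrite ler0n.
  rewrite [mup x p]mupNroot ?sub0r.
    by apply/min_idPl; rewrite oppr_le0.
  by apply: contraL qx => px; apply: coprimep_root px.
(* At infinity the pole order is the excess of the degree of [p] over that of [q], or 0 if there is
   none. *)
have Fi : F None = (size b).-1%:Z - (size a).-1%:Z -
    ((maxn (size p) (size q)).-1%:Z - (size q).-1%:Z) * M.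
  have minE : Order.min (- (size p).-1%:Z - - (size q).-1%:Z) 0 =
      (size q).-1%:Z - (maxn (size p) (size q)).-1%:Z.
    rewrite opprK addrC; have [le|/ltnW le] := leqP (size p) (size q).
      rewrite subrr; apply/min_idPr; rewrite subr_ge0 lez_nat -!subn1.
      by rewrite leq_sub2r.
    by apply/min_idPl; rewrite subr_le0 lez_nat -!subn1 leq_sub2r.
  by rewrite /F gE !ord_at_fraction //= minE; ring.
have uS : uniq (None :: map Some s).
  by rewrite /= map_inj_uniq ?us ?andbT; [apply/mapP => -[]|move=> ? ? []].
transitivity (\sum_(c \in [set: option C]) F c) => //.
(* Away from infinity and the roots of [a], [b] and [q] every term vanishes, so the sum is
   finite. *)
rewrite (fsbigE (None :: map Some s)) //; last first.
  case=> [x|//] _; rewrite inE /= mem_map => [xs|? ? [] //].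
  rewrite FE !mupNroot ?mul0r ?subr0 //.
  - exact: contra (@qP x) xs.
  - exact: contra (@bP x) xs.
  - exact: contra (@aP x) xs.
under eq_bigl do rewrite in_setT.
rewrite big_cons big_map Fi; under eq_bigr do rewrite FE.
have sumZ r : r != 0 -> (forall x, root r x -> x \in s) ->
    \sum_(x <- s) (mup x r)%:Z = (size r).-1%:Z.
  by move=> r0 rP; rewrite -(sum_mup r0 us rP) (big_morph Posz PoszD (erefl _)).
rewrite !big_split /= !sumrN -mulr_suml !sumZ //.
by ring.
Qed.

(** Characteristic 0 enters here: the leading coefficient is multiplied by a nonzero integer. *)
Lemma deriv_eq0_size p : p^`() = 0 -> (size p <= 1)%N.
Proof.
move=> p'0; case sp: (size p) => [|[|m]] //.
have /eqP : p^`()`_m = 0 by rewrite p'0 coef0.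
rewrite coef_deriv mulrn_eq0 /= => /eqP pm.
by have := lead_coef_eq0 p; rewrite lead_coefE sp pm eqxx -size_poly_eq0 sp.
Qed.

(** If [p' q = p q'], coprimality gives that [p] divides [p'] and [q] divides [q']; by degree both
    derivatives are 0, so both polynomials are constant. *)
Lemma wronskian_neq0 p q : coprimep p q -> (1 < maxn (size p) (size q))%N ->
  p^`() * q - p * q^`() != 0.
Proof.
move=> pq; apply: contraTneq => /eqP; rewrite subr_eq0 => /eqP E.
have aux (a b : {poly C}) : coprimep a b -> a %| a^`() * b -> (size a <= 1)%N.
  move=> ab; rewrite Gauss_dvdpl // => aa'; apply: deriv_eq0_size.
  have [->|a0] := eqVneq a 0; first by rewrite deriv0.
  apply: contraTeq aa' => a'0; apply/negP => /(dvdp_leq a'0).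
  by rewrite leqNgt lt_size_deriv.
rewrite -leqNgt geq_max; apply/andP; split.
  by apply: aux pq _; rewrite E dvdp_mulr.
by apply: (aux q p); [rewrite coprimep_sym|rewrite mulrC -E dvdp_mull].
Qed.

(* A multiple root of p - v q is a zero of the Wronskian, hence is avoided by a
   generic v. *)
Lemma generic_fibre p q s : coprimep p q -> (2 < maxn (size p) (size q))%N ->
  exists v x y, [/\ x != y, x \notin s /\ y \notin s,
    q.[x] != 0 /\ p.[x] / q.[x] = v & q.[y] != 0 /\ p.[y] / q.[y] = v].
Proof.
move=> pq N2; have W0 := wronskian_neq0 pq (ltnW N2).
have [rW [_ rWP]] := roots_seq W0.
(* Avoiding 0 and the quotient of leading coefficients keeps the degree of [p - v q] equal to the
   larger of the two degrees; avoiding the other values keeps the fibre off [s] and off the zeros of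
   the Wronskian. *)
have [v] := closed_avoid [:: 0, lead_coef p / lead_coef q &
  [seq p.[x] / q.[x] | x <- s ++ rW]].
rewrite !inE !negb_or => /and3P[v0 vlc vimg].
set r := p - v *: q.
have rx x : root r x -> q.[x] != 0 /\ p.[x] = v * q.[x].
  rewrite /root !hornerE subr_eq0 => /eqP pvq; split=> //.
  apply/eqP => qx; have := @coprimep_root _ _ _ x pq.
  by rewrite /root pvq qx mulr0 eqxx => /(_ isT).
have rval x : root r x -> p.[x] / q.[x] = v.
  by move=> /rx[qx ->]; rewrite mulfK.
have rs x : root r x -> x \notin s ++ rW.
  by move=> /rval E; apply: contra vimg => xs; apply/mapP; exists x.
(* The coefficient of [r] at the larger of the two degrees is nonzero, whichever of [p] and [q]
   attains it. *)
have size_r : (2 < size r)%N.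
  apply: leq_trans (N2) _; rewrite -[X in (X <= _)%N]prednK; last first.
    by rewrite (leq_trans _ N2).
  rewrite ltnNge; apply/negP => /leq_sizeP/(_ _ (leqnn _))/eqP; apply/negP.
  rewrite !coefE; case: ltngtP => pq_size.
  - rewrite [p`_ _]nth_default ?sub0r; last by rewrite -ltnS prednK // (leq_trans _ pq_size).
    rewrite oppr_eq0 mulf_neq0 // -lead_coefE lead_coef_eq0 -size_poly_gt0.
    exact: leq_trans pq_size.
  - rewrite [q`_ _]nth_default; last by rewrite -ltnS prednK // (leq_trans _ pq_size).
    rewrite mulr0 subr0 -lead_coefE lead_coef_eq0 -size_poly_gt0.
    exact: leq_trans pq_size.
  rewrite -[p`_ _]lead_coefE [in q`_ _]pq_size -[q`_ _]lead_coefE.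
  have q0 : lead_coef q != 0.
    rewrite lead_coef_eq0 -size_poly_gt0 -pq_size.
    by move: N2; rewrite -pq_size maxnn; apply: ltn_trans.
  by apply: contra vlc; rewrite subr_eq0 => /eqP ->; rewrite mulfK.
have [[|x [|y t]] rE] := closed_field_poly_normal r.
- by move: size_r; rewrite ltnNge rE big_nil (leq_trans (size_scale_leq _ _)) ?size_poly1.
- move: size_r; rewrite ltnNge rE big_seq1.
  by rewrite (leq_trans (size_scale_leq _ _)) ?size_XsubC.
have r0 : lead_coef r != 0 by rewrite lead_coef_eq0 -size_poly_gt0 (ltn_trans _ size_r).
have rootx : root r x by rewrite rE rootZ // root_prod_XsubC inE eqxx.
have rooty : root r y by rewrite rE rootZ // root_prod_XsubC !inE eqxx orbT.
move: (rs x rootx) (rs y rooty); rewrite !mem_cat !negb_or => /andP[xs xW] /andP[ys _].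
have [[qx _] [qy _]] := (rx _ rootx, rx _ rooty).
exists v, x, y; split; rewrite ?rval //; apply: contraNneq xW => xy; apply: rWP.
have r'x : r^`().[x] = 0.
  have -> : r = (lead_coef r *: \prod_(z <- t) ('X - z%:P) * ('X - x%:P)) * ('X - x%:P).
    by rewrite {1}rE !big_cons -xy -!mul_polyC; ring.
  by rewrite derivM hornerD !hornerM hornerXsubC subrr !(mulr0, mul0r) addr0.
have [_ px] := rx _ rootx.
have p'x : p^`().[x] = v * q^`().[x].
  by apply/eqP; rewrite -subr_eq0 -r'x derivB derivZ !hornerE.
by rewrite rootE !hornerE px p'x mulrAC subrr.
Qed.

End GenericFibre.

(** * Points of the toric variety in a chart *)

Section Toric.

Variable beta : nat -> nat -> int.

Local Notation ray := (ray beta).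
Local Notation generators := (generators beta).
Local Notation dual_basis := (dual_basis beta).

(** * Rays and dual bases of the maximal cones *)

Section Dual.

Variable n : nat.
Implicit Types (m : 'rV[int]_n) (s : chart n) (i k : 'I_n).

Lemma ray_entry i b k :
  ray (i, b) 0 k = if b then (k == i)%:R
                   else - (k == i)%:R - (if (i < k)%N then beta i k else 0).
Proof.
rewrite /ray; case: b => /=; first by rewrite mxE eqxx.
rewrite !mxE eqxx summxE; congr (_ - _); rewrite big_mkcond (bigD1 k) //=.
rewrite big1 ?addr0 => [|l lk]; first by case: ifP; rewrite ?mxE ?eqxx ?mulr1.
by case: ifP; rewrite // !mxE (eq_sym k) (negPf lk) andbF mulr0.
Qed.

Lemma pairing_delta m i : pairing m (delta_mx 0 i) = m 0 i.
Proof.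
rewrite /pairing (bigD1 i) //= big1 ?addr0 ?mxE ?eqxx ?mulr1 // => k ki.
by rewrite mxE (negPf ki) mulr0.
Qed.

Lemma pairing0 v : pairing (0 : 'rV_n) v = 0.
Proof. by rewrite /pairing big1 // => i _; rewrite mxE mul0r. Qed.

Lemma pairingDl m m' v : pairing (m + m') v = pairing m v + pairing m' v.
Proof. by rewrite -big_split; apply: eq_bigr => i _; rewrite mxE mulrDl. Qed.

Lemma pairingNl m v : pairing (- m) v = - pairing m v.
Proof. by rewrite -sumrN; apply: eq_bigr => i _; rewrite mxE mulNr. Qed.

Lemma pairing_ray m i b :
  pairing m (ray (i, b)) =
  if b then m 0 i else - m 0 i - \sum_(k < n | (i < k)%N) m 0 k * beta i k.
Proof.
case: b; first by rewrite /= pairing_delta.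
rewrite /pairing.
under eq_bigr do rewrite ray_entry mulrBr.
rewrite big_split sumrN /=; congr (_ - _).
  rewrite (bigD1 i) //= eqxx mulrN1 big1 ?addr0 // => k /negPf ->.
  by rewrite oppr0 mulr0.
by rewrite [RHS]big_mkcond; apply: eq_bigr => k _; case: ifP; rewrite ?mulr0.
Qed.

(** The matrix is upper triangular with diagonal entries 1 or -1, so each maximal cone is smooth. *)
Lemma generators_unit s : generators s \in unitmx.
Proof.
rewrite -unitmx_tr unitmxE det_trig; last first.
  apply/is_trig_mxP => i k ik; rewrite !mxE ray_entry.
  by rewrite -val_eqE (ltn_eqF ik) ltnNge ltnW //; case: (s k); rewrite ?oppr0 ?addr0.
apply: rpred_prod => i _; rewrite !mxE ray_entry eqxx ltnn.
by case: (s i); rewrite ?subr0 ?unitrN ?unitr1.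
Qed.

Lemma pairing_generators m s i :
  pairing m (ray (i, s i)) = (m *m (generators s)^T) 0 i.
Proof. by rewrite mxE; apply: eq_bigr => k _; rewrite !mxE. Qed.

Lemma dual_basisE s i : dual_basis s i = row i (invmx (generators s))^T.
Proof. by rewrite -tr_col. Qed.

Lemma dual_basis_ray s i k :
  pairing (dual_basis s i) (ray (k, s k)) = (k == i)%:R.
Proof.
rewrite pairing_generators dual_basisE -row_mul -trmx_mul mulmxV ?generators_unit //.
by rewrite !mxE.
Qed.

Lemma dual_basis_expansion s m :
  m = \sum_i pairing m (ray (i, s i)) *: dual_basis s i.
Proof.
have uG : (generators s)^T \in unitmx by rewrite unitmx_tr generators_unit.
rewrite -[LHS](mulmxK uG).
rewrite -trmx_inv mulmx_sum_row; apply: eq_bigr => i _.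
by rewrite -pairing_generators -dual_basisE.
Qed.

(** Back substitution from the last coordinate: the ray of index [k] has no coordinates before [k],
    and those after [k] are handled by the induction on [n - k]. *)
Lemma dual_basis_lower s i k : (i < k)%N -> dual_basis s i 0 k = 0.
Proof.
have [l] := ubnP (n - k); elim: l k => // l IHl k nk ik.
have: pairing (dual_basis s i) (ray (k, s k)) = 0.
  by rewrite dual_basis_ray -val_eqE (gtn_eqF ik).
rewrite pairing_ray big1 => [|h kh].
  by case: (s k) => // /eqP; rewrite subr0 oppr_eq0 => /eqP.
rewrite IHl ?mul0r // ?(ltn_trans ik) //.
by rewrite ltnS in nk; apply: leq_trans nk; apply: ltn_sub2l; rewrite ?ltn_ord.
Qed.

(** The vectors [e_i^-] and [- e_i^+] differ only in coordinates after [i], where the dual basis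
    vector vanishes. *)
Lemma dual_basis_opposite s i :
  pairing (dual_basis s i) (ray (i, ~~ s i)) = -1.
Proof.
have := dual_basis_ray s i i; rewrite eqxx !pairing_ray big1 => [|k ik].
  by rewrite subr0; case: (s i) => /= [->|/eqP] //; rewrite eqr_oppLR => /eqP.
by rewrite dual_basis_lower ?mul0r.
Qed.

(** This detects charts: if coordinate [i] of the chart [s] is regular on a cone, the cone cannot
    contain the ray opposite to that of [s]. *)
Lemma dual_basis_ge0 s i b : 0 <= pairing (dual_basis s i) (ray (i, b)) -> b = s i.
Proof.
have [-> //|/eqP] := eqVneq b (s i).
by case: b; case: (s i) (dual_basis_opposite s i) => //= -> .
Qed.

End Dual.

(** * Points described by their coordinates in an affine chart *)

Section ChartPoint.

Variables (K : fieldType) (n : nat).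
Implicit Types (m : 'rV[int]_n) (s t : chart n) (v : 'I_n -> K).
Implicit Types (A : {set 'I_n * bool}) (q : germ K n).

(* The point with coordinates v in the chart t; it lies in the orbit of the cone
   of the generators at which the coordinate vanishes. *)
Definition chart_point t v : germ K n := fun m =>
  if [forall i, (v i == 0) ==> (0 <= pairing m (ray (i, t i)))]
  then Some (\prod_i v i ^ pairing m (ray (i, t i))) else None.

Definition chart_cone t v : {set 'I_n * bool} :=
  [set (i, t i) | i in [pred i | v i == 0]]%SET.

Lemma mem_chart_cone t v i b :
  ((i, b) \in chart_cone t v) = (v i == 0) && (b == t i).
Proof.
apply/imsetP/andP => [[k vk [-> ->]]|[vi /eqP ->]]; first by rewrite eqxx.
by exists i.
Qed.

Lemma chart_cone_fan t v : chart_cone t v \in fan n.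
Proof.
rewrite inE; apply/forallP => i; rewrite !mem_chart_cone.
by case: (t i); rewrite /= ?andbF.
Qed.

Lemma dual_chart_cone t v m :
  dual_cone beta (chart_cone t v) m =
  [forall i, (v i == 0) ==> (0 <= pairing m (ray (i, t i)))].
Proof.
apply/forallP/forallP => [H i|H [i b]]; apply/implyP.
  by move=> vi; apply: (implyP (H (i, t i))); rewrite mem_chart_cone vi eqxx.
by rewrite mem_chart_cone => /andP[vi /eqP ->]; apply: (implyP (H i)).
Qed.

Lemma eq_chart_point t t' v v' :
  t =1 t' -> v =1 v' -> chart_point t v = chart_point t' v'.
Proof. by move=> /ffunP -> /funext ->. Qed.

Lemma chart_point_orbit t v : torus_orbit beta (chart_cone t v) (chart_point t v).
Proof.
split=> [m||m m' x x'|m x]; rewrite ?dual_chart_cone /chart_point.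
- by case: ifP.
- rewrite ifT; last by apply/forallP => i; rewrite pairing0 lexx implybT.
  by congr Some; rewrite big1 // => i _; rewrite pairing0 expr0z.
- case: ifP => // /forallP mv [<-]; case: ifP => // /forallP m'v [<-].
  have ge0 i : (v i == 0) ==> (0 <= pairing (m + m') (ray (i, t i))).
    apply/implyP => vi; rewrite pairingDl.
    by rewrite addr_ge0 ?(implyP (mv i)) ?(implyP (m'v i)).
  rewrite ifT; last exact/forallP; congr Some; rewrite -big_split.
  apply: eq_bigr => i _; rewrite pairingDl /=; have [vi|vi] := eqVneq (v i) 0.
    by rewrite exprzD_ss // (implyP (mv i)) ?(implyP (m'v i)) ?vi.
  by rewrite expfzDr.
(* A nonzero value forces exponent 0 at every vanishing coordinate, so the opposite character is
   regular too. *)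
- case: ifP => // /forallP mv [<-] /prodf_neq0 nz; rewrite ifT //.
  apply/forallP => i; apply/implyP => vi; have := nz i isT.
  rewrite (eqP vi) exp0rz pairingNl.
  by have [-> _|] := eqVneq (pairing m (ray (i, t i))) 0; rewrite ?oppr0 ?eqxx.
Qed.

Lemma chart_point_toric t v : toric_limit beta K n (chart_point t v).
Proof.
by exists (chart_cone t v); [exact: chart_cone_fan|exact: chart_point_orbit].
Qed.

(** Another chart contains the point exactly when its cone keeps the rays at which the coordinate
    vanishes, that is, the generators of the cone of the orbit. *)
Lemma in_chart_point s t v :
  in_chart beta s (chart_point t v) = [forall i, (v i == 0) ==> (s i == t i)].
Proof.
apply/forallP/forallP => H i.
  apply/implyP => vi; have := H i; rewrite /chart_point; case: ifP => // + _.
  by move=> /forallP/(_ i)/implyP/(_ vi)/dual_basis_ge0 <-.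
rewrite /chart_point ifT //; apply/forallP => k; apply/implyP => vk.
by rewrite -(eqP (implyP (H k) vk)) dual_basis_ray ler0n.
Qed.

Lemma chart_point_coord t v i : chart_coord beta t (chart_point t v) i = v i.
Proof.
rewrite /chart_coord /chart_point ifT; last first.
  by apply/forallP => k; rewrite dual_basis_ray ler0n implybT.
rewrite /= (bigD1 i) //= dual_basis_ray eqxx big1 ?mulr1 // => k ki.
by rewrite dual_basis_ray (negPf ki).
Qed.

Lemma chart_point_inj t v v' : chart_point t v = chart_point t v' -> v =1 v'.
Proof. by move=> E i; rewrite -(chart_point_coord t v) E chart_point_coord. Qed.

Lemma in_chart_orbit A s q i b :
  torus_orbit beta A q -> in_chart beta s q -> (i, b) \in A -> b = s i.
Proof.
move=> [Aq _ _ _] /forallP/(_ i); rewrite Aq => /forallP/(_ (i, b))/implyP sA.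
by move=> /sA; apply: dual_basis_ge0.
Qed.

(** The cone [A] is a face of the maximal cone [s]. The monoid morphism is then determined by its
    values on the dual basis of [s], and these vanish exactly at the generators in [A]. *)
Lemma orbit_chart_point A s q :
    torus_orbit beta A q -> (forall i b, (i, b) \in A -> b = s i) ->
  q = chart_point s (chart_coord beta s q) /\
  (forall i, (chart_coord beta s q i == 0) = ((i, s i) \in A)).
Proof.
move=> [Aq q0 qD qN] As.
have dualE m : dual_cone beta A m =
    [forall i, ((i, s i) \in A) ==> (0 <= pairing m (ray (i, s i)))].
  apply/forallP/forallP => [H i|H [i b]]; first exact: H (i, s i).
  by apply/implyP => iA; have iAE := As _ _ iA; subst b; apply: (implyP (H i)).
have qB i : q (dual_basis s i) = Some (chart_coord beta s q i).
  rewrite /chart_coord; have := Aq (dual_basis s i); rewrite dualE.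
  case: (q _) => //= /esym/negP[]; apply/forallP => k.
  by rewrite dual_basis_ray ler0n implybT.
have qNB i : isSome (q (- dual_basis s i)) = ((i, s i) \notin A).
  rewrite Aq dualE; apply/forallP/idP => [/(_ i)|iA k].
    rewrite pairingNl dual_basis_ray eqxx.
    by case: (_ \in A).
  rewrite pairingNl dual_basis_ray; have [->|] := eqVneq k i; last by rewrite oppr0 implybT.
  by rewrite (negPf iA).
(* A coordinate is nonzero exactly when its inverse character is also regular at [q]. *)
have v0 i : (chart_coord beta s q i == 0) = ((i, s i) \in A).
  apply/idP/idP => [/eqP vi|iA]; last first.
    apply: contraTT iA => vi; rewrite -qNB; exact: qN (qB i) vi.
  apply: contraT; rewrite -qNB; case qNi: (q _) => [x|] // _.
  have := qD _ _ _ _ (qB i) qNi; rewrite subrr q0 vi mul0r => -[] /eqP.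
  by rewrite oner_eq0.
split=> //; apply/funext => m; rewrite /chart_point.
have -> : [forall i, (chart_coord beta s q i == 0) ==> (0 <= pairing m (ray (i, s i)))]
    = dual_cone beta A m.
  by rewrite dualE; apply: eq_forallb => i; rewrite v0.
case: ifP => [Am|]; last by rewrite -Aq; case: (q m).
have qX i (k : nat) : q (k%:Z *: dual_basis s i) = Some (chart_coord beta s q i ^+ k).
  elim: k => [|k IHk]; first by rewrite scale0r q0.
  by rewrite -[in LHS](addn1 k) PoszD scalerDl scale1r (qD _ _ _ _ IHk (qB i)) exprSr.
(* Negative exponents occur only outside [A]; there the value at the opposite character is the
   inverse of the coordinate. *)
have qZ i (k : int) : (((i, s i) \in A) ==> (0 <= k)) ->
    q (k *: dual_basis s i) = Some (chart_coord beta s q i ^ k).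
  case: k => k; first by rewrite qX.
  rewrite implybF => /[dup] iA; rewrite -qNB.
  case qNi: (q _) => [x|] // _.
  have xE : x = (chart_coord beta s q i)^-1.
    have := qD _ _ _ _ (qB i) qNi; rewrite subrr q0 => -[E].
    by apply: (mulfI (x := chart_coord beta s q i)); rewrite ?v0 // -E mulfV ?v0.
  rewrite NegzE scaleNr -scalerN -exprnN -exprVn -xE.
  elim: k.+1 => [|h IHh]; first by rewrite scale0r q0.
  by rewrite -[in LHS](addn1 h) PoszD scalerDl scale1r (qD _ _ _ _ IHh qNi) exprSr.
have Ami i : ((i, s i) \in A) ==> (0 <= pairing m (ray (i, s i))).
  by move: Am; rewrite dualE => /forallP.
rewrite {1}(dual_basis_expansion s m).
apply: (big_ind2 (fun m x => q m = Some x)) => //.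
by move=> m1 x1 m2 x2 E1 E2; apply: qD.
by move=> i _; apply: qZ.
Qed.

Lemma in_chart_pointE s q : toric_limit beta K n q -> in_chart beta s q ->
  q = chart_point s (chart_coord beta s q).
Proof.
move=> [A _ Aq] sq; have [] // := orbit_chart_point Aq (s := s).
by move=> i b; apply: in_chart_orbit Aq sq.
Qed.

Lemma toric_limit_chart q : toric_limit beta K n q ->
  exists t, in_chart beta t q.
Proof.
move=> [A]; rewrite inE => /forallP Afan Aq.
(* Completes [A] to a maximal cone: [e_i^-] is taken where it lies in [A], and [e_i^+] at all other
   indices. *)
pose t : chart n := [ffun i => (i, false) \notin A].
exists t; have [|-> _] := orbit_chart_point (s := t) Aq.
  move=> i b; rewrite ffunE; have := Afan i.
  by case: b; case: (_ \in A) => //; case: (_ \in A).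
by rewrite in_chart_point; apply/forallP => i; rewrite eqxx implybT.
Qed.

Lemma in_chart_coord s t v : (forall i, v i = 0 -> s i = t i) ->
  in_chart beta s (chart_point t v).
Proof.
by move=> st; rewrite in_chart_point; apply/forallP => i; apply/implyP => /eqP/st ->.
Qed.

End ChartPoint.

(** * The Schubert line *)

Section SchubertLine.

Variable K : fieldType.

Local Notation widen := (widen_ord (leqnSn _)).

Lemma ord_max_or_widen n (i : 'I_n.+1) : i = ord_max \/ exists k, i = widen k.
Proof.
by case: (unliftP ord_max i) => [k ->|->]; [right; exists k; apply/val_inj/lift_max|left].
Qed.

(** A pulled-back character has last coordinate 0. Thus the projection maps the rays of the first
    [n] indices to those of the smaller fan, and the two rays of the last index to 0. *)
Lemma pairing_pullback n (m : 'rV[int]_n) (i : 'I_n) b :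
  pairing (m *m (pid_mx n : 'M_(n.+1, n))^T) (ray (widen i, b)) =
  pairing m (ray (i, b)).
Proof.
have mE k : (m *m (pid_mx n : 'M_(n.+1, n))^T) 0 (widen k) = m 0 k.
  rewrite mxE (bigD1 k) //= big1 ?addr0 => [|l lk]; rewrite !mxE /=.
    by rewrite eqxx ltn_ord mulr1.
  by rewrite eq_sym val_eqE (negPf lk) mulr0.
have m0 : (m *m (pid_mx n : 'M_(n.+1, n))^T) 0 ord_max = 0.
  by rewrite mxE big1 // => l _; rewrite !mxE /= ltnn andbF mulr0.
rewrite !pairing_ray mE big_mkcond big_ord_recr /= m0 mul0r if_same addr0.
by rewrite [in RHS]big_mkcond; under eq_bigr do rewrite mE.
Qed.

Lemma pairing_pullback_max n (m : 'rV[int]_n) b :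
  pairing (m *m (pid_mx n : 'M_(n.+1, n))^T) (ray (ord_max, b)) = 0.
Proof.
have m0 : (m *m (pid_mx n : 'M_(n.+1, n))^T) 0 ord_max = 0.
  by rewrite mxE big1 // => l _; rewrite !mxE /= ltnn andbF mulr0.
rewrite pairing_ray m0 big1 ?subr0 ?oppr0 ?if_same // => k.
by rewrite /= ltnNge -ltnS ltn_ord.
Qed.

Definition restrict_chart n (t : chart n.+1) : chart n := [ffun i => t (widen i)].

(** The last coordinate enters pulled-back characters with exponent 0, so in charts the fibration
    drops it. *)
Lemma fibration_chart_point n (t : chart n.+1) (v : 'I_n.+1 -> K) :
  fibration (chart_point t v) =
  chart_point (restrict_chart t) (fun i => v (widen i)).
Proof.
apply/funext => m; rewrite /fibration /toric_map /chart_point.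
have -> : [forall i, (v i == 0) ==> (0 <= pairing
    (m *m (pid_mx n : 'M_(n.+1, n))^T) (ray (i, t i)))] =
  [forall i, (v (widen i) == 0) ==>
             (0 <= pairing m (ray (i, restrict_chart t i)))].
  apply/forallP/forallP => H i.
    by have := H (widen i); rewrite pairing_pullback ffunE.
  case: (ord_max_or_widen i) => [->|[k ->]]; first by rewrite pairing_pullback_max implybT.
  by have := H k; rewrite ffunE -pairing_pullback.
rewrite big_ord_recr /= pairing_pullback_max expr0z mulr1.
by under eq_bigr do rewrite pairing_pullback -[t _](ffunE (fun i => t (widen i))).
Qed.

Lemma schubert_pointE n (t : chart n) : t =1 xpredT ->
  @schubert_point beta K n = chart_point t (fun=> 0).
Proof.
move=> tT; apply/funext => m; rewrite /schubert_point /torus_fixed_point.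
have -> : [set (i, true) | i : 'I_n]%SET = chart_cone t (fun=> 0 : K).
  apply/setP => -[i b]; rewrite mem_chart_cone eqxx tT.
  by apply/imsetP/eqP => [[k _ []]|->] //; exists i.
rewrite dual_chart_cone /chart_point; case: ifP => // _; congr Some.
(* As [0 ^ k] is 1 for [k = 0] and 0 otherwise, the product is the indicator of the characters
   orthogonal to the cone. *)
under eq_bigr do rewrite exp0rz.
have [/forallP m0|] := boolP (perp_cone _ _ _).
  rewrite big1 // => i _; have := m0 (i, t i).
  by rewrite mem_chart_cone !eqxx => /eqP ->.
rewrite negb_forall => /existsP[[i b]]; rewrite negb_imply mem_chart_cone eqxx /=.
by move=> /andP[/eqP -> /negPf mi]; rewrite (bigD1 i) //= mi mul0r.
Qed.

(** The origin of a chart lies in no other chart, since all its coordinates vanish. *)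
Lemma chart_point_eq0 n (t t' : chart n) (v : 'I_n -> K) :
  chart_point t v = chart_point t' (fun=> 0) -> t = t' /\ v =1 fun=> 0.
Proof.
move=> E; have tt' : t = t'.
  have : in_chart beta t (chart_point t v) by apply: in_chart_coord.
  rewrite E in_chart_point => /forallP tt'; apply/ffunP => i.
  by apply/eqP/(implyP (tt' i)).
by split=> //; move: E; rewrite tt' => /chart_point_inj.
Qed.

(** The choice made by [xget] is forced: on the divisor the last coordinate is 0, and the image
    under the fibration gives the others. *)
Lemma schubert_section_chart_point n (t : chart n.+1) (v : 'I_n.+1 -> K) :
    t ord_max -> v ord_max = 0 ->
  schubert_section beta (chart_point (restrict_chart t) (fun i => v (widen i))) =
  chart_point t v.
Proof.
move=> tT v0; apply: xget_unique => [|q [[A [Afan maxA Aq]]] qE].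
  split; last exact: fibration_chart_point.
  exists (chart_cone t v); split; first exact: chart_cone_fan.
    by rewrite mem_chart_cone v0 tT !eqxx.
  exact: chart_point_orbit.
(* The cone of [q] is a face of [t]: at the last index because the fan forbids opposite rays, at the
   others because the image of [q] lies in the restricted chart. *)
have As i b : (i, b) \in A -> b = t i.
  case: (ord_max_or_widen i) => [->|[k ->]] kA.
    move: Afan; rewrite inE => /forallP/(_ ord_max); rewrite maxA tT.
    by case: b kA => // ->.
  have : isSome (fibration q (dual_basis (restrict_chart t) k)).
    rewrite qE; move/forallP: (in_chart_coord (s := restrict_chart t)
      (t := restrict_chart t) (v := fun i => v (widen i)) (fun=> fun=> erefl)).
    exact.
  case: Aq => Aq _ _ _; rewrite /fibration /toric_map Aq.
  move=> /forallP/(_ (widen k, b))/implyP/(_ kA).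
  by rewrite pairing_pullback => /dual_basis_ge0 ->; rewrite ffunE.
have [] := orbit_chart_point Aq As.
move: (chart_coord beta t q) => v' qC v'0; rewrite qC in qE *.
apply: eq_chart_point => // i.
move: qE; rewrite fibration_chart_point => /chart_point_inj vE.
case: (ord_max_or_widen i) => [->|[k ->]]; last exact: vE.
by apply/eqP; rewrite v0 v'0 tT.
Qed.

(** All signs are positive except possibly at [j]. As [j] is a natural number, the formula serves
    every dimension; for [j >= n] it gives the all-positive chart. *)
Definition line_chart n j b : chart n := [ffun i : 'I_n => (val i != j) || b].

Definition line_coord n j (c : K) (i : 'I_n) : K := if val i == j then c else 0.

Definition line_point n j b c : germ K n :=
  chart_point (line_chart n j b) (line_coord j c).

Lemma restrict_line_chart n j b :
  restrict_chart (line_chart n.+1 j b) = line_chart n j b.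
Proof. by apply/ffunP => i; rewrite !ffunE. Qed.

(** Induction on the dimension: the line starts as the fibre over the origin of the all-positive
    chart, and each later section appends a coordinate 0 with positive sign. *)
Lemma schubert_lineE n j : (j < n)%N ->
  schubert_line beta K j n = [set q | exists b c, q = line_point j b c].
Proof.
elim: n => // n IHn; rewrite ltnS leq_eqVlt => /predU1P[->|jn] /=.
  rewrite eqxx; have tT : line_chart n n true =1 xpredT by move=> i; rewrite ffunE orbT.
  rewrite (schubert_pointE tT); apply/seteqP; split=> q /=.
    case=> /[dup] qt /toric_limit_chart[t tq]; rewrite (in_chart_pointE qt tq).
    move: (chart_coord _ _ _) => v; rewrite fibration_chart_point.
    move=> /chart_point_eq0[tE vE]; exists (t ord_max), (v ord_max).
    apply: eq_chart_point => i.
      rewrite ffunE; case: (ord_max_or_widen i) => [->|[k ->]] /=.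
        by rewrite eqxx.
      by rewrite (ltn_eqF (ltn_ord k)) -[t _](ffunE (fun i => t (widen i)))
           [finfun _]tE ffunE orbT.
    rewrite /line_coord; case: (ord_max_or_widen i) => [->|[k ->]] /=.
      by rewrite eqxx.
    by rewrite (ltn_eqF (ltn_ord k)) vE.
  move=> [b [c ->]]; split; first exact: chart_point_toric.
  rewrite fibration_chart_point restrict_line_chart; apply: eq_chart_point => i.
    by rewrite !ffunE /= neq_ltn ltn_ord.
  by rewrite /line_coord /= (ltn_eqF (ltn_ord i)).
have secE b c : schubert_section beta (line_point j b c : germ K n) = line_point j b c.
  rewrite [RHS]/line_point -schubert_section_chart_point ?restrict_line_chart //.
    by rewrite ffunE /= gtn_eqF.
  by rewrite /line_coord /= gtn_eqF.
rewrite gtn_eqF // IHn //; apply/seteqP; split=> q /=.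
  by move=> [p [b [c ->]] <-]; exists b, c.
by move=> [b [c ->]]; exists (line_point j b c); [exists b, c|].
Qed.

(** * The two charts of the line and the canonical cocycle between them *)

Section Line.

Variables (n : nat) (j : 'I_n).

Lemma line_chartE b i : line_chart n j b i = (i != j) || b.
Proof. by rewrite ffunE. Qed.

Lemma line_coordE c i : line_coord j c i = if i == j then c else 0 :> K.
Proof. by []. Qed.

(** This is the relation expressing [e_i^+ + e_i^-] through later basis vectors, which is symmetric
    in the two signs. *)
Lemma pairing_opposite (m : 'rV[int]_n) i b :
  pairing m (ray (i, ~~ b)) =
  - pairing m (ray (i, b)) - \sum_(k < n | (i < k)%N) m 0 k * beta i k.
Proof. by rewrite !pairing_ray; case: b; rewrite //= opprB opprK addrC addKr. Qed.

(** Both sides are defined where [m 0 i >= 0] for all [i != j]. If some such entry is nonzero, both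
    values are 0; otherwise the correction in [pairing_opposite] vanishes and the exponents at [j]
    are opposite. *)
Lemma line_point_inv b (c : K) : c != 0 ->
  line_point j b c = line_point j (~~ b) c^-1 :> germ K n.
Proof.
move=> c0; apply/funext => m; rewrite /line_point /chart_point.
have sameE b' i : i != j -> ray (i, line_chart n j b' i) = ray (i, true).
  by move=> ij; rewrite line_chartE ij.
have domE b' (c' : K) : c' != 0 ->
    [forall i, (line_coord j c' i == 0) ==>
      (0 <= pairing m (ray (i, line_chart n j b' i)))] =
    [forall i, (i != j) ==> (0 <= m 0 i)].
  move=> c'0; apply: eq_forallb => i; rewrite line_coordE.
  have [->|ij] := eqVneq i j; first by rewrite (negPf c'0).
  by rewrite eqxx sameE // pairing_ray.
rewrite !domE ?invr_eq0 //; case: ifP => // /forallP m_ge0; congr Some.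
have prodE b' (c' : K) : \prod_i line_coord j c' i ^
      pairing m (ray (i, line_chart n j b' i)) =
    c' ^ pairing m (ray (j, b')) * \prod_(i | i != j) ((m 0 i == 0)%:R : K).
  rewrite (bigD1 j) //= line_coordE eqxx line_chartE eqxx; congr (_ * _).
  apply: eq_bigr => i ij; rewrite line_coordE (negPf ij) sameE //.
  by rewrite pairing_ray exp0rz.
rewrite !prodE; have [/existsP[i /andP[ij mi]]|] := boolP [exists i, (i != j) && (m 0 i != 0)].
  by rewrite (bigD1 i) //= (negPf mi) !mul0r !mulr0.
rewrite negb_exists => /forallP m0; congr (_ * _).
rewrite pairing_opposite big1 ?subr0 -?exprz_inv ?invrK // => k jk.
have := m0 k; rewrite -val_eqE gtn_eqF //= negbK => /eqP ->.
by rewrite mul0r.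
Qed.

Lemma in_chart_line_point s b (c : K) :
  in_chart beta s (line_point j b c) -> s = line_chart n j (s j).
Proof.
rewrite in_chart_point => /forallP sE; apply/ffunP => i; rewrite line_chartE.
have := sE i; rewrite line_coordE line_chartE.
by have [->|] := eqVneq i j; rewrite ?eqxx // => _ /eqP ->.
Qed.

Lemma line_chart_line_point b b' (c : K) : c != 0 ->
  in_chart beta (line_chart n j b') (line_point j b c).
Proof.
move=> c0; apply: in_chart_coord => i; rewrite line_coordE !line_chartE.
by have [_ E|] := eqVneq i j; first by rewrite E eqxx in c0.
Qed.

Lemma in_line_chart_line_point b (c : K) :
  in_chart beta (line_chart n j b) (line_point j b c).
Proof. exact: in_chart_coord. Qed.

Lemma line_point_coord b (c : K) :
  chart_coord beta (line_chart n j b) (line_point j b c) =1 line_coord j c.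
Proof. exact: chart_point_coord. Qed.

Lemma line_point_inj b (c c' : K) :
  line_point j b c = line_point j b c' :> germ K n -> c = c'.
Proof. by move=> /chart_point_inj/(_ j); rewrite !line_coordE eqxx. Qed.

Lemma transition_line b i k :
  transition beta (line_chart n j b) (line_chart n j (~~ b)) i k =
  if k == j then - (i == j)%:R - (if (j < i)%N then beta j i else 0)
  else (k == i)%:R.
Proof.
rewrite /transition; have [->|kj] := eqVneq k j; last first.
  by rewrite line_chartE kj -(dual_basis_ray (line_chart n j (~~ b))) line_chartE kj.
have -> : line_chart n j b j = ~~ line_chart n j (~~ b) j.
  by rewrite !line_chartE eqxx negbK.
rewrite pairing_opposite dual_basis_ray (eq_sym j); congr (_ - _).
(* At an index [l > j] the chart has the ray [e_l^+], so the [l]-th entry of a dual basis vector is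
   0 or 1 by duality. *)
rewrite big_mkcond (bigD1 i) //= big1 ?addr0 => [|l li]; case: ifP => // jl.
  have := dual_basis_ray (line_chart n j (~~ b)) i i.
  by rewrite line_chartE -val_eqE gtn_eqF //= pairing_ray eqxx => ->; rewrite mul1r.
have := dual_basis_ray (line_chart n j (~~ b)) i l.
rewrite line_chartE -val_eqE gtn_eqF //= pairing_ray (negPf li) => ->.
by rewrite mul0r.
Qed.

Lemma canonical_cocycle_id s (p : germ K n) : canonical_cocycle beta s s p = 1.
Proof.
rewrite /canonical_cocycle; have -> : jacobian beta s s p = 1%:M; last exact: det1.
apply/matrixP => i l; rewrite !mxE /monomial_deriv /transition dual_basis_ray.
rewrite eq_sym; have [->|] := eqVneq i l; last by rewrite mul0r.
by rewrite big1 ?mulr1 // => k _; rewrite dual_basis_ray natz subrr expr0z.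
Qed.

Lemma canonical_cocycle_line b (c : K) : c != 0 ->
  canonical_cocycle beta (line_chart n j b) (line_chart n j (~~ b))
    (line_point j b c) = - c ^ (- 2 - \sum_(k < n | (j < k)%N) beta j k).
Proof.
move=> c0; rewrite /canonical_cocycle.
(* Exponent of [c] in the diagonal entry at [i]; the -2 comes from differentiating [x_j ^ (-1)]. The
   vanishing coordinates occur there with exponent 0 and contribute 1. *)
pose e i := if i == j then - 2 else - (if (j < i)%N then beta j i else 0).
have -> : jacobian beta (line_chart n j b) (line_chart n j (~~ b)) (line_point j b c) =
    diag_mx (\row_i ((if i == j then -1 else 1) * c ^ e i)).
  apply/matrixP => i l; rewrite !mxE /monomial_deriv.
  under eq_bigr do rewrite line_point_coord line_coordE.
  rewrite !transition_line; have [<-|il] := eqVneq i l.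
    rewrite mulr1n (bigD1 j) //= !eqxx big1 ?mulr1 => [|k kj]; last first.
      by rewrite transition_line (negPf kj) natz subrr expr0z.
    rewrite transition_line eqxx /e.
    by have [->|ij] := eqVneq i j; rewrite ?ltnn ?eqxx ?subr0 ?sub0r.
  (* Off the diagonal only the derivative in [x_j] has a nonzero coefficient, and it retains the
     factor [x_i], which is 0 on the axis. *)
  rewrite mulr0n; have [lj|lj] := eqVneq l j; last by rewrite mul0r.
  move: il; rewrite lj => ij; rewrite (bigD1 i) //= transition_line (negPf ij) eqxx.
  by rewrite subr0 expr1z mul0r mulr0.
rewrite det_diag; under eq_bigr do rewrite mxE.
rewrite big_split /= (bigD1 j) //= eqxx big1 ?mulr1 ?mulN1r => [|i /negPf -> //].
congr (- _); rewrite -(big_morph _ (fun x y => expfzDr x y c0) (expr0z c)).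
congr (_ ^ _); rewrite (bigD1 j) //= {1}/e eqxx; congr (_ + _).
rewrite -sumrN [RHS]big_mkcond [LHS]big_mkcond; apply: eq_bigr => i _; rewrite /e.
by have [->|_] := eqVneq i j; rewrite ?ltnn //; case: ifP; rewrite ?oppr0.
Qed.

End Line.

End SchubertLine.

(** * Normalizations of the line and the degree of the canonical bundle *)

Section LineDegree.

Variables (C : numClosedFieldType) (n : nat) (j : 'I_n).

Local Notation L := (schubert_line beta C j n).
Local Notation deg := (- 2 - \sum_(k < n | (j < k)%N) beta j k).

Lemma schubert_line_point b c : L (line_point j b c).
Proof. by rewrite schubert_lineE //; exists b, c. Qed.

Lemma schubert_lineP q : L q -> exists b c, q = line_point j b c.
Proof. by rewrite schubert_lineE. Qed.

Lemma schubert_line_coord v i :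
  L (chart_point (line_chart n j true) v) -> i != j -> v i = 0.
Proof.
move=> /schubert_lineP[b [c]] E ij.
have [c' {}E] : exists c', chart_point (line_chart n j true) v = line_point j true c'.
  case: b E => E; first by exists c.
  (* The only point of the line outside the main chart is the origin of the other one. *)
  have [c0|c0] := eqVneq c 0; last by exists c^-1; rewrite E line_point_inv.
  have /chart_point_eq0[/ffunP/(_ j)] : chart_point (line_chart n j true) v =
      chart_point (line_chart n j false) (fun=> 0).
    by rewrite E c0; apply: eq_chart_point => // k; rewrite /line_coord if_same.
  by rewrite !line_chartE eqxx.
by rewrite (chart_point_inj E) line_coordE (negPf ij).
Qed.

Lemma image_chart_point s (phi : 'I_n -> {fraction {poly C}})
    (p q : 'I_n -> {poly C}) x :
    (forall i, phi i = (p i)%:F / (q i)%:F) -> (forall i, (q i).[x] != 0) ->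
  image_point beta (chart_point s phi) (Some x)
    (chart_point s (fun i => (p i).[x] / (q i).[x])).
Proof.
move=> phiE qx; split; first exact: chart_point_toric.
exists s; split=> [||i]; try exact: in_chart_coord.
by rewrite !chart_point_coord phiE; apply: has_value_fraction.
Qed.

Lemma image_line_point (p q : {poly C}) x : q.[x] != 0 ->
  image_point beta (line_point j true (p%:F / q%:F)) (Some x)
    (line_point j true (p.[x] / q.[x]) : germ C n).
Proof.
move=> qx.
pose P (i : 'I_n) := if i == j then p else 0.
pose Q (i : 'I_n) := if i == j then q else 1.
have -> : line_point j true (p.[x] / q.[x]) =
    chart_point (line_chart n j true) (fun i => (P i).[x] / (Q i).[x]).
  apply: eq_chart_point => // i; rewrite line_coordE /P /Q.
  by case: ifP; rewrite // !hornerE ?mul0r.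
apply: image_chart_point => i; rewrite ?line_coordE /P /Q; case: ifP => //.
  by rewrite tofrac0 mul0r.
by rewrite hornerE oner_neq0.
Qed.

(** Regularity forces the second chart at poles of [p / q] and the first at its zeros; elsewhere the
    two charts give equal orders. Each term is therefore the order in the first chart, corrected by
    [deg] times the pole order, and [sum_ord_at] applies with [M = - deg]. *)
Lemma pullback_degree_line (p q : {poly C}) d :
    p != 0 -> q != 0 -> coprimep p q ->
    pullback_degree beta (@canonical_cocycle beta _ n)
      (line_point j true (p%:F / q%:F)) d ->
  d = (maxn (size p) (size q)).-1%:Z * deg.
Proof.
move=> p0 q0 pq [h [a [h0 hg reg ->]]].
have phi0 : p%:F / q%:F != 0 by rewrite mulf_neq0 ?invr_eq0 ?tofrac_eq0.
have sumE g0 := sum_ord_at (- deg) g0 p0 q0 pq.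
move: (p%:F / q%:F) phi0 sumE h0 hg reg => phi phi0 sumE h0 hg reg.
have in_line b : in_chart beta (line_chart n j b) (line_point j true phi).
  exact: line_chart_line_point.
have ord_h c : ord_at c (h (line_chart n j true)) =
    ord_at c (h (line_chart n j false)) + ord_at c phi * deg.
  rewrite (hg _ _ (in_line true) (in_line false)) (canonical_cocycle_line j true phi0).
  have h2 := h0 _ (in_line false).
  have phiX : phi ^ deg != 0 by exact: (expfz_neq0 _ phi0).
  by rewrite mulrN (ord_atN _ (mulf_neq0 h2 phiX)) (ord_atM _ h2 phiX) (ord_atX _ _ phi0).
rewrite -[RHS]mulrNN -(sumE _ (h0 _ (in_line true))).
apply: eq_fsbigr => c _; have [ac /(_ j)[v]] := reg c.
rewrite (in_chart_line_point ac); case: (a c j).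
  rewrite line_point_coord line_coordE eqxx => /(has_value_ord_ge0 phi0) ord0.
  by rewrite (min_idPr ord0) mul0r addr0.
rewrite line_point_inv // line_point_coord line_coordE eqxx.
move=> /has_value_ord_ge0; rewrite invr_eq0 ord_atV // oppr_ge0 => /(_ phi0) ord0.
by rewrite (min_idPl ord0) ord_h mulrN addrK.
Qed.

Lemma normalization_line nu : normalization beta nu L ->
  exists p q : {poly C}, [/\ p != 0, q != 0, coprimep p q,
    maxn (size p) (size q) = 2 & nu = line_point j true (p%:F / q%:F)].
Proof.
move=> [nuT imL [S inj]].
have inL c q : image_point beta nu c q -> L q by move=> cq; rewrite -imL; exists c.
(* The image contains the origin of the main chart, which lies in no other chart, so [nu] meets the
   main chart. *)
have nu_chart : in_chart beta (line_chart n j true) nu.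
  have := schubert_line_point true 0; rewrite -imL => -[c [_ [s [snu s0 _]]]].
  suff <- : s = line_chart n j true by [].
  apply/ffunP => i; move: s0; rewrite in_chart_point => /forallP/(_ i)/implyP.
  by rewrite line_coordE if_same eqxx => /(_ isT)/eqP.
have nuE := in_chart_pointE nuT nu_chart.
move: (chart_coord _ _ _) nuE => phi nuE.
have [pq pqP] := choice (fun i => fraction_coprime (phi i)).
(* If this coordinate were not identically 0, a parameter avoiding its zeros and all poles would be
   sent off the axis. *)
have phi0 i : i != j -> phi i = 0.
  move=> ij; have [_ _ ->] := pqP i; suff -> : (pq i).1 = 0 by rewrite tofrac0 mul0r.
  apply/eqP; apply: contraT => pi0.
  have : (pq i).1 * \prod_k (pq k).2 != 0.
    by rewrite mulf_neq0 //; apply/prodf_neq0 => k _; case: (pqP k).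
  move=> /closed_nonrootP[x]; rewrite rootM negb_or => /andP[pix qx].
  have qkx k : (pq k).2.[x] != 0.
    apply: contra qx => /eqP qkx; rewrite (bigD1 k) //= rootM.
    by rewrite [root _ x]rootE qkx eqxx.
  have := image_chart_point (line_chart n j true) (p := fun k => (pq k).1)
    (q := fun k => (pq k).2) (phi := phi) (x := x).
  rewrite -nuE => /(_ _ qkx) H.
  have {}H : L (chart_point (line_chart n j true) (fun k => (pq k).1.[x] / (pq k).2.[x])).
    by apply: inL (H _) => k; case: (pqP k).
  have /eqP := schubert_line_coord H ij.
  by rewrite mulf_eq0 invr_eq0 (negPf (qkx i)) orbF -rootE (negPf pix).
have [cop q0 phij] := pqP j; move: (pq j).1 (pq j).2 cop q0 phij => p q cop q0 phij.
have {}nuE : nu = line_point j true (p%:F / q%:F).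
  rewrite nuE; apply: eq_chart_point => // i; rewrite line_coordE.
  by have [->|/phi0] := eqVneq i j.
(* Here [pmap id S] is the finite part of the exceptional set. *)
have image_inj x y : x \notin pmap id S -> y \notin pmap id S ->
    q.[x] != 0 -> q.[y] != 0 -> p.[x] / q.[x] = p.[y] / q.[y] -> x = y.
  move=> xS yS qx qy xy; have := image_line_point p qx; rewrite xy -nuE => imx.
  have := image_line_point p qy; rewrite -nuE => imy.
  rewrite !mem_pmap !map_id in xS yS.
  by case: (inj _ _ _ xS yS imx imy).
(* Size 2 means degree 1. It also excludes [p = 0], since coprimality would make [q] constant. *)
suff N2 : maxn (size p) (size q) = 2.
  exists p, q; split=> //; apply: contra_eqN N2 => /eqP p0.
  move: cop; rewrite p0 coprime0p size_poly0 max0n -size_poly_eq1 => /eqP ->.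
  by [].
(* Degree at least 2 gives a generic fibre with two points, and degree 0 a constant map; both
   contradict generic injectivity. *)
apply/eqP; rewrite eqn_leq; apply/andP; split; rewrite leqNgt; apply/negP => N.
  have [v [x [y [xy [xS yS] [qx vx] [qy vy]]]]] := generic_fibre (pmap id S) cop N.
  by move/eqP: xy; apply; apply: image_inj; rewrite ?vx.
have [x xS] := closed_avoid (pmap id S).
have [y] := closed_avoid (x :: pmap id S); rewrite inE negb_or => /andP[yx yS].
move: N; rewrite ltnS geq_max => /andP[/size1_polyC pE /size1_polyC qE].
have qz z : q.[z] != 0 by rewrite qE hornerC -polyC_eq0 -qE.
move/eqP: yx; apply; apply: image_inj => //.
by rewrite pE qE !hornerC.
Qed.

Lemma normalization_line_param :
  normalization beta (line_point j true ('X%:F / 1%:F)) L.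
Proof.
have imX x : image_point beta (line_point j true ('X%:F / 1%:F)) (Some x)
    (line_point j true x : germ C n).
  by have := @image_line_point 'X 1 x; rewrite !hornerE (divr1 x); apply; apply: oner_neq0.
rewrite tofrac1 divr1 in imX *.
have X0 : ('X : {poly C})%:F != 0 by rewrite tofrac_eq0 polyX_eq0.
have valX := @has_valueX C; have valXV := @has_valueXV C.
have valXVi := has_value_infty C.
move: ('X%:F) X0 imX valX valXV valXVi => z z0 imz valz valzV valzVi.
set nu := line_point _ _ _.
have nuE : nu = line_point j false z^-1 by rewrite /nu line_point_inv.
(* Each image point is read off in one of the two charts of the line, where the only possibly
   nonzero coordinate is [z] or its inverse. *)
have im_coord c q : image_point beta nu c q -> exists b v,
    q = line_point j b v /\ has_value_at c (if b then z else z^-1) v.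
  move=> [qT [s [snu sq val]]]; have sE := in_chart_line_point snu.
  exists (s j), (chart_coord beta s q j); split.
    rewrite [LHS](in_chart_pointE qT sq); apply: eq_chart_point => i; first by rewrite -sE.
    rewrite line_coordE; have [-> //|ij] := eqVneq i j.
    apply: (@has_value0_eq _ c); have := val i; rewrite {1}sE.
    by case: (s j); [|rewrite nuE]; rewrite line_point_coord line_coordE (negPf ij).
  have := val j; rewrite {1}sE.
  by case: (s j); [|rewrite nuE]; rewrite line_point_coord line_coordE eqxx.
have im_unique x q : image_point beta nu (Some x) q -> q = line_point j true x.
  move=> /im_coord[[] [v [->]]]; first by move=> /valz ->.
  move=> /valzV vx; have v0 : v != 0.
    by apply: contraTneq (oner_neq0 C) => v0; rewrite -vx v0 mul0r eqxx.
  rewrite (line_point_inv j false v0); congr (line_point j _ _).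
  by apply: (mulfI v0); rewrite vx mulfV.
split.
- exact: chart_point_toric.
- apply/seteqP; split=> q /=.
    by move=> [c /im_coord[b [v [-> _]]]]; apply: schubert_line_point.
  move=> /schubert_lineP[[] [c ->]]; first by exists (Some c).
  have [->|c0] := eqVneq c 0; last by exists (Some c^-1); rewrite line_point_inv.
  (* The origin of the second chart is the image of infinity, where [1 / z] vanishes. *)
  exists None; split; first exact: chart_point_toric.
  exists (line_chart n j false); rewrite nuE; split=> [||i].
  + exact: in_line_chart_line_point.
  + exact: in_line_chart_line_point.
  rewrite !line_point_coord !line_coordE; case: ifP => _; last exact: has_value0.
  exact: valzVi.
exists [:: None] => -[x|] c q; last by rewrite inE eqxx.
case: c => [y|] _; last by rewrite inE eqxx.
by move=> _ /im_unique -> /im_unique/line_point_inj ->.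
Qed.

(** Existence is enough here, as [pullback_degree_line] determines the value. *)
Lemma pullback_degree_line_param : exists d,
  pullback_degree beta (@canonical_cocycle beta _ n)
    (line_point j true (('X : {poly C})%:F / 1%:F)) d.
Proof.
rewrite tofrac1 divr1.
have X0 : ('X : {poly C})%:F != 0 by rewrite tofrac_eq0 polyX_eq0.
have valX (x : C) := (has_valueX x x).2 erefl; have valXV := has_value_infty C.
move: ('X%:F) X0 valX valXV => z z0 valz valzV; set nu := line_point _ _ _.
have nuE : nu = line_point j false z^-1 by rewrite /nu line_point_inv.
have g10 : canonical_cocycle beta (line_chart n j true) (line_chart n j false) nu =
    - z ^ deg by rewrite (canonical_cocycle_line j true z0).
have : canonical_cocycle beta (line_chart n j false) (line_chart n j true) nu =
    - z^-1 ^ deg by rewrite nuE (canonical_cocycle_line j false) ?invr_eq0.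
rewrite exprz_inv -invr_expz => g01.
have zX0 : z ^ deg != 0 by exact: (expfz_neq0 _ z0).
(* The section is the trivializing one in the first chart, so its coefficient in the second is the
   inverse of the cocycle. The second chart is used only at infinity. *)
eexists; exists (fun s : chart n => if s j then 1 else - (z ^ deg)^-1),
  (fun c : option C => line_chart n j (c != None)); split; last by [].
- move=> s _; case: ifP => _; first exact: oner_neq0.
  by rewrite oppr_eq0 invr_eq0.
- move=> s t snu tnu; rewrite (in_chart_line_point snu) (in_chart_line_point tnu).
  rewrite !line_chartE eqxx /=; case: (s j); case: (t j).
  + by rewrite canonical_cocycle_id mulr1.
  + by rewrite g10 mulrNN mulVf.
  + by rewrite g01 mul1r.
  + by rewrite canonical_cocycle_id mulr1.
- move=> c; split; first exact: (line_chart_line_point j true (c != None) z0).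
  case: c => [x|] i /=; last first.
    rewrite nuE line_point_coord line_coordE; exists 0.
    by case: ifP => _; [exact: valzV|exact: has_value0].
  rewrite /nu line_point_coord line_coordE; case: ifP => _.
    by exists x; exact: valz.
  by exists 0; exact: has_value0.
Qed.

(** As [xget] picks an arbitrary degree, two facts are needed: some normalization has a degree, and
    every degree of every normalization is [deg]. *)
Lemma canonical_degree_schubert_line : canonical_degree beta L = deg.
Proof.
have degE p q d : p != 0 -> q != 0 -> coprimep p q -> maxn (size p) (size q) = 2 ->
    pullback_degree beta (@canonical_cocycle beta _ n)
      (line_point j true ((p : {poly C})%:F / q%:F)) d -> d = deg.
  by move=> p0 q0 pq N2 /pullback_degree_line ->; rewrite ?N2 ?mul1r.
apply: xget_unique => [|d [nu /normalization_line[p [q [p0 q0 pq N2 ->]]]]].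
  have [d nud] := pullback_degree_line_param.
  exists (line_point j true ('X%:F / 1%:F)); first exact: normalization_line_param.
  rewrite -(degE 'X 1 d) ?polyX_eq0 ?oner_eq0 ?coprimep1 //.
  by rewrite size_polyX size_poly1.
exact: degE.
Qed.

End LineDegree.

End Toric.

Theorem proposition7p4 (R : realType) (D : kac_moody_datum) (r : nat)
    (w : r.-tuple (km_index D)) (j : 'I_r) :
  canonical_degree (word_beta w) (schubert_line (word_beta w) R[i]%type j r)
  = - 2 - \sum_(k < r | (j < k)%N) word_beta w j k.
Proof. exact: canonical_degree_schubert_line. Qed.
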